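(* For every integer $k$, the class of graphs with layered tree-independence number at most $k$ has independence degeneracy at most $3k$ (that is, every graph with layered tree-independence number at most $k$ has independence degeneracy at most $3k$).
   Context: All graphs are finite, simple and nonnull; $\alpha$ is the independence number. The independence degeneracy of $G$ is the maximum, over all nonnull induced subgraphs $H$ of $G$, of the minimum, over all $v\in V(H)$, of the independence number of the subgraph of $H$ induced by the neighborhood $N_H(v)$. A tree decomposition of $G$ is a pair $(T,\{X_t\}_{t\in V(T)})$ with $T$ a tree and bags $X_t\subseteq V(G)$ such that every vertex is in some bag, both endpoints of every edge lie in a common bag, and for each $u\in V(G)$ the nodes $t$ with $u\in X_t$ induce a connected subgraph of $T$. A layering of $G$ is an ordered partition $(V_0,V_1,\ldots)$ of $V(G)$ (parts may be empty, all but finitely many are) such that for each edge $uv$ with $u\in V_i$, $v\in V_j$ we have $|i-j|\le 1$. The layered tree-independence number of $G$ is the minimum $\ell$ such that there are a tree decomposition and a layering of $G$ with $\alpha(G[X_t\cap V_i])\le\ell$ for every bag $X_t$ and layer $V_i$. *)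

(* Defs.v *)
From mathcomp Require Import all_boot all_order all_algebra.
From mathcomp Require Import boolp.

Set Implicit Arguments.
Unset Strict Implicit.
Unset Printing Implicit Defensive.

Record sgraph := SGraph {
  vertex :> finType;
  adj : rel vertex;
  adj_sym : symmetric adj;
  adj_irrefl : irreflexive adj;
  vertex_nonnull : 0 < #|vertex| }.

Arguments adj {s} : rename.

Definition nbh (G : sgraph) (v : G) : {set G} := [set u | adj v u].

Definition stable (G : sgraph) (S : {set G}) : bool :=
  [forall u in S, forall v in S, ~~ adj u v].

(* The independence number of the induced subgraph G[A]; A may be empty. *)
Definition alpha (G : sgraph) (A : {set G}) : nat :=
  \max_(S : {set G} | (S \subset A) && stable S) #|S|.

(* A nonnull induced subgraph H of G is given by its vertex set S <> set0, so
   that N_H(v) = N_G(v) :&: S. As alpha never exceeds #|G|, the default #|G| of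
   the iterated minimum does not affect its value when S is nonempty. *)
Definition indep_degeneracy (G : sgraph) : nat :=
  \max_(S : {set G} | S != set0)
    \big[minn/#|G|]_(v in S) alpha (nbh v :&: S).

Definition connected_in (G : sgraph) (A : {set G}) : Prop :=
  {in A &, forall x y,
    connect [rel u v | [&& u \in A, v \in A & adj u v]] x y}.

(* In a simple graph a duplicate-free cyclic sequence of length at least 3 is
   a cycle; those of length 2 are just edges. *)
Definition acyclic (G : sgraph) : Prop :=
  forall c : seq G, ucycle adj c -> size c < 3.

Definition is_tree (T : sgraph) : Prop :=
  connected_in [set: T] /\ acyclic T.

Definition tree_decomposition (G T : sgraph) (X : T -> {set G}) : Prop :=
  [/\ is_tree T,
      forall u : G, exists t : T, u \in X t,
      forall u v : G, adj u v -> exists t : T, (u \in X t) && (v \in X t)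
    & forall u : G, connected_in [set t | u \in X t]].

(* Since G is finite, all but finitely many layers are automatically empty. *)
Definition layering (G : sgraph) (V : nat -> {set G}) : Prop :=
  (forall u : G, exists! i, u \in V i) /\
  (forall (u v : G) (i j : nat),
     adj u v -> u \in V i -> v \in V j -> `|i - j|%N <= 1).

Definition has_layered_tree_alpha (G : sgraph) (l : nat) : Prop :=
  exists (T : sgraph) (X : T -> {set G}) (V : nat -> {set G}),
    [/\ tree_decomposition X, layering V
      & forall (t : T) (i : nat), alpha (X t :&: V i) <= l].

Lemma alpha_leq_card (G : sgraph) (A : {set G}) : alpha A <= #|G|.
Proof. by apply/bigmax_leqP => S _; apply: max_card. Qed.

Definition one_vertex_graph : sgraph.
Proof.
by apply: (@SGraph unit (fun _ _ => false)) => //; rewrite card_unit.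
Defined.

Lemma one_vertex_tree : is_tree one_vertex_graph.
Proof.
split; first by case=> [] [] _ _; apply: connect0.
by move=> [|x [|y [|z c]]] //= /andP[].
Qed.

Lemma ex_layered_tree_alpha (G : sgraph) :
  exists l, `[< has_layered_tree_alpha G l >].
Proof.
exists #|G|; apply/asboolP.
exists one_vertex_graph, (fun=> setT), (fun i => if i == 0 then setT else set0).
split; last by move=> *; apply: alpha_leq_card.
- split; first exact: one_vertex_tree.
  + by move=> u; exists tt; rewrite inE.
  + by move=> u v _; exists tt; rewrite !inE.
  + by move=> u [] [] _ _; apply: connect0.
- split=> [u|u v [|i] [|j]]; rewrite ?inE //.
  exists 0; split; first by rewrite eqxx inE.
  by case=> // i; rewrite inE.
Qed.

(* The minimum; asbool (classical) makes the predicate boolean for ex_minn. *)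
Definition layered_tree_alpha (G : sgraph) : nat :=
  ex_minn (ex_layered_tree_alpha G).

(* Main.v *)
Require Import Defs.
From mathcomp Require Import all_boot all_order all_algebra.
From mathcomp Require Import boolp zify.

Set Implicit Arguments.
Unset Strict Implicit.
Unset Printing Implicit Defensive.

(** Root the tree of the decomposition. Among the vertices of the induced
    subgraph, choose v such that the top node t of its subtree is deepest. Then
    every neighbour of v in the subgraph lies in the bag of t, and in one of the
    three layers around that of v; a stable set of neighbours of v thus splits
    into three stable sets, each inside the intersection of that bag with one
    layer. *)

Lemma alpha_ge (G : sgraph) (A I : {set G}) :
  I \subset A -> stable I -> #|I| <= alpha A.
Proof.
move=> sIA stI.
by apply: (@leq_bigmax_cond _ (fun S : {set G} => (S \subset A) && stable S));
  rewrite sIA.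
Qed.

Lemma stable_sub (G : sgraph) (I J : {set G}) :
  J \subset I -> stable I -> stable J.
Proof.
move=> /subsetP sJI /forall_inP stI; apply/forall_inP => u uJ.
apply/forall_inP => v vJ; move/forall_inP: (stI u (sJI u uJ)); apply.
exact: sJI.
Qed.

Lemma bigminn_le (I : finType) (A : {set I}) (n : nat) (F : I -> nat) (i : I) :
  i \in A -> \big[minn/n]_(j in A) F j <= F i.
Proof.
move=> iA; have := mem_index_enum i.
elim: (index_enum I) => // j s IHs; rewrite inE big_cons.
case: eqP => [<- _|_ /= /IHs les]; first by rewrite iA geq_minl.
by case: ifP => // _; apply: leq_trans les; apply: geq_minr.
Qed.

(** Deletion of [t] keeps the vertex type and merely isolates [t], which avoids building a
    subgraph. *)
Definition del_rel (G : sgraph) (t : G) : rel G :=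
  [rel u v | [&& u != t, v != t & adj u v]].

Lemma del_rel_sym (G : sgraph) (t : G) : symmetric (del_rel t).
Proof. by move=> x y; rewrite /del_rel /= adj_sym andbCA. Qed.

(** If [p] and [q] differed, a duplicate-free path between them that misses [t] would close up
    through [t] to a cycle of length at least 3. *)
Lemma acyclic_del_connect (G : sgraph) (t p q : G) :
  acyclic G -> adj t p -> adj t q -> connect (del_rel t) p q -> p = q.
Proof.
move=> acG tp tq /connectP[s0 ps0 qE]; rewrite {q}qE in tq *.
case/shortenP: ps0 tq => s ps us _ tq.
case: s => [|x s] // in ps us tq *.
have tNs : t \notin p :: x :: s.
  apply/negP => ts.
  have /allP/(_ t ts) : all (fun y => y != t) (p :: x :: s).
    have : p != t by case/andP: ps => /and3P[].
    elim: {us tq ts}(x :: s) (p) ps => [|z s' IHs] y /=.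
      by move=> _ ->.
    by case/andP=> /and3P[_ zt _] ps yt; rewrite yt; apply: IHs.
  by rewrite eqxx.
have padj : path adj p (x :: s).
  by apply: sub_path ps => y z /and3P[].
suff /acG : ucycle adj [:: t, p, x & s] by [].
apply/andP; split; last by rewrite cons_uniq tNs.
rewrite -[cycle _ _]/(path adj t (rcons [:: p, x & s] t)) rcons_path.
by apply/andP; split; [apply/andP | rewrite adj_sym].
Qed.

(** Take the distance from [r]: the vertex before [x] on a shortest walk from [r] is nearer. This is
    all the rooting that is needed, with [y] as a parent of [x]. *)
Lemma ex_rank (G : sgraph) (r : G) :
  connected_in [set: G] ->
  exists d : G -> nat, forall x, x != r -> exists2 y, adj x y & d y < d x.
Proof.
move=> cG.
have ex x : exists n, [exists p : n.-tuple G, path adj r p && (last r p == x)].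
  have /connectP[p pp xE] := cG r x (in_setT _) (in_setT _).
  exists (size p); apply/existsP; exists (in_tuple p).
  apply/andP; split; last by rewrite -xE.
  by apply: sub_path pp => y z /and3P[].
exists (fun x => ex_minn (ex x)) => x xr.
case: (ex_minnP (ex x)) => n /existsP[[p /= /eqP szp] /andP[pp /eqP lp]] _.
case/lastP: p => [|p z] in szp pp lp *; first by rewrite -lp eqxx in xr.
rewrite last_rcons in lp; rewrite {}lp in szp pp.
move: pp; rewrite rcons_path => /andP[pp px].
exists (last r p); first by rewrite adj_sym.
case: ex_minnP => m _ /(_ (size p)) lem.
rewrite -szp size_rcons ltnS; apply: lem.
by apply/existsP; exists (in_tuple p); rewrite /= pp eqxx.
Qed.

Section Rank.

Variables (T : sgraph) (r : T) (d : T -> nat).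
Hypothesis dP : forall x, x != r -> exists2 y, adj x y & d y < d x.

(** Walk from parent to parent: after the first step the rank is strictly below [d t], so the walk
    never meets [t]. *)
Lemma connect_root_del (t x : T) :
  d x <= d t -> x != t -> t != r -> connect (del_rel t) x r.
Proof.
move: {2}(d x) (leqnn (d x)) => n.
elim: n x => [|n IHn] x dxn dxt xt tr;
  have [->|/dP[y xy dyx]] := eqVneq x r; try exact: connect0.
  by move: dxn dyx; rewrite leqn0 => /eqP->.
have yt : y != t by apply: contraTneq dyx => ->; rewrite -leqNgt.
apply: (@connect_trans _ _ y); first by apply: connect1; rewrite /del_rel /= xt yt.
by apply: IHn => //; lia.
Qed.

(* If t were not in B, deleting t would leave its neighbours towards the root
   (reached through B) and towards s (reached through A) connected: a cycle. *)
Lemma top_mem (A B : {set T}) (t s w : T) :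
  acyclic T -> connected_in A -> connected_in B ->
  t \in A -> (forall x, x \in A -> d t <= d x) ->
  s \in A -> s \in B -> w \in B -> d w <= d t -> t \in B.
Proof.
move=> acT cA cB tA tmin sA sB wB dwt; apply: contraT => tB.
have neqB x : x \in B -> x != t by apply: contraTneq => ->.
have wt := neqB _ wB.
(* The root has least rank, whereas [w], if [t] were the root, would have a neighbour of rank below
   [d t]. *)
have tr : t != r.
  apply: contraTneq dwt => tr; have [|y _ dyw] := @dP w; first by rewrite -tr.
  have : forall x, d r <= d x.
    move=> x; move: {2}(d x) (leqnn (d x)) => n.
    elim: n x => [|n IHn] x dxn; have [->//|/dP[z _ dz]] := eqVneq x r.
      by lia.
    by apply: leq_trans (ltnW dz); apply: IHn; lia.
  by move/(_ y); rewrite -ltnNge tr; lia.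
have [p tp dp] := dP tr.
have pt : p != t by apply: contraTneq dp => ->; rewrite ltnn.
have sw : connect (del_rel t) s w.
  apply: connect_sub (cB s w sB wB) => x y /and3P[xB yB xy].
  by apply: connect1; rewrite /del_rel /= !neqB.
have sp : connect (del_rel t) s p.
  apply: connect_trans sw _.
  apply: connect_trans (connect_root_del dwt wt tr) _.
  rewrite (sym_connect_sym (@del_rel_sym _ t)).
  by apply: connect_root_del => //; apply: ltnW.
(* Inside [A], a duplicate-free path from [t] to [s] is nonempty, since [s] is in [B] and [t] is
   not; from its second node [q] on it avoids [t]. *)
have /connectP[s0 ps0] := cA t s tA sA.
case/shortenP: ps0 => c pc uc _ sE.
case: c => [|q c] in pc uc sE *; first by rewrite /= in sE; rewrite -sE sB in tB.
case/andP: pc => /and3P[_ qA tq] pc.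
have qs : connect (del_rel t) q s.
  apply/connectP; exists c => //.
  case/andP: uc => tqc _.
  elim: c q {qA tq sE} pc tqc => //= z c IHc q /andP[/and3P[_ _ qz] pc].
  rewrite !inE !negb_or => /and3P[tq tz tc].
  rewrite /del_rel /= qz eq_sym tq eq_sym tz /=; apply: IHc => //.
  by rewrite inE negb_or tz.
(* The neighbours [q] and [p] of [t] must coincide, but [q] lies in [A], where no rank is below
   [d t], while [d p < d t]. *)
have qp := acyclic_del_connect acT tq tp (connect_trans qs sp).
by have := tmin q qA; rewrite qp leqNgt dp.
Qed.

End Rank.

Lemma ex_nbh_sub_bag (G T : sgraph) (X : T -> {set G}) (S : {set G}) :
  tree_decomposition X -> S != set0 ->
  exists v t, v \in S /\ nbh v :&: S \subset X t.
Proof.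
move=> [[cT acT] cov ecov cX] /set0Pn[v0 v0S].
have [r _] : exists r : T, r \in T by apply/card_gt0P; apply: vertex_nonnull.
have [d dP] := ex_rank r cT.
have exn u : exists n, [exists t, (u \in X t) && (d t == n)].
  by have [t ut] := cov u; exists (d t); apply/existsP; exists t; rewrite ut /=.
pose top u := ex_minn (exn u).
have topP u : exists2 t, u \in X t & d t = top u.
  rewrite /top; case: ex_minnP => n /existsP[t /andP[ut /eqP dt]] _.
  by exists t.
have top_min u t : u \in X t -> top u <= d t.
  move=> ut; rewrite /top; case: ex_minnP => n _; apply.
  by apply/existsP; exists t; rewrite ut /=.
case: (arg_maxnP top v0S) => v vS vmax.
have [t vt dt] := topP v.
exists v, t; split=> //; apply/subsetP => u; rewrite !inE => /andP[vu uS].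
have [s /andP[vs us]] := ecov v u vu.
have [w uw dw] := topP u.
suff : t \in [set t | u \in X t] by rewrite inE.
(* The subtrees of [v] and [u] meet in [s], as [uv] is an edge; [w] is a top node of [u], no deeper
   than [t] by the choice of [v]. *)
apply: (@top_mem T r d dP [set t | v \in X t] _ t s w);
  rewrite ?inE //.
  by move=> x; rewrite inE dt; apply: top_min.
by rewrite dw dt; apply: vmax.
Qed.

Lemma alpha_nbh_layers (G : sgraph) (V : nat -> {set G}) (v : G)
    (A B : {set G}) (l : nat) :
  layering V -> A \subset nbh v -> A \subset B ->
  (forall i, alpha (B :&: V i) <= l) -> alpha A <= 3 * l.
Proof.
move=> [Vex Vadj] /subsetP Av AB lB; apply/bigmax_leqP => I /andP[IA stI].
have [i [vi _]] := Vex v.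
have leI j : #|I :&: V j| <= l.
  apply: leq_trans (lB j); apply: alpha_ge.
    by apply: setSI; apply: subset_trans IA AB.
  by apply: stable_sub stI; apply: subsetIl.
(* For [i = 0] the first two pieces coincide, which does not harm the bound. *)
have cov : I \subset (I :&: V i.-1) :|: (I :&: V i) :|: (I :&: V i.+1).
  apply/subsetP => u uI.
  have vu : adj v u by have := Av u (subsetP IA u uI); rewrite inE.
  have [j [uj _]] := Vex u.
  have := Vadj v u i j vu vi uj => ij.
  have [jE|[jE|jE]] : j = i.-1 \/ j = i \/ j = i.+1 by lia.
  - by rewrite !inE uI -jE uj.
  - by rewrite !inE uI -jE uj orbT.
  - by rewrite !inE uI -jE uj !orbT.
have := subset_leq_card cov.
have := (leq_card_setU (I :&: V i.-1 :|: I :&: V i) (I :&: V i.+1)).1.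
have := (leq_card_setU (I :&: V i.-1) (I :&: V i)).1.
by have := leI i.-1; have := leI i; have := leI i.+1; lia.
Qed.

Lemma layered_tree_alphaP (G : sgraph) :
  has_layered_tree_alpha G (layered_tree_alpha G).
Proof. by rewrite /layered_tree_alpha; case: ex_minnP => l /asboolP. Qed.

Lemma indep_degeneracy_le (G : sgraph) (l : nat) :
  has_layered_tree_alpha G l -> indep_degeneracy G <= 3 * l.
Proof.
move=> [T [X [V [tdX layV lXV]]]]; apply/bigmax_leqP => S S0.
have [v [t [vS sub]]] := ex_nbh_sub_bag tdX S0.
apply: leq_trans (bigminn_le _ _ vS) _.
exact: (alpha_nbh_layers layV (subsetIl _ _) sub (lXV t)).
Qed.

Theorem lemma6p1 (k : int) (G : sgraph) :
  ((layered_tree_alpha G)%:Z <= k)%R -> ((indep_degeneracy G)%:Z <= 3 * k)%R.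
Proof. by move=> lek; have := indep_degeneracy_le (layered_tree_alphaP G); lia. Qed.
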